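(* Let $(\mathcal X,\mathcal Y)$ be an admissible balanced pair in an abelian category $\mathcal A$ and let $(\mathcal C,\mathcal D)$ be a cotorsion pair relative to $(\mathcal X,\mathcal Y)$. Then $(\mathcal C,\mathcal D)$ has enough projectives if and only if it has enough injectives.
   Context: $\mathcal A$ is an abelian category; a subcategory of $\mathcal A$ means a full additive subcategory closed under isomorphisms and direct summands. A morphism $f:X\to M$ with $X\in\mathcal X$ is a right $\mathcal X$-approximation of $M$ if every morphism $X'\to M$ with $X'\in\mathcal X$ factors through $f$; $\mathcal X$ is contravariantly finite in $\mathcal A$ if every object of $\mathcal A$ has a right $\mathcal X$-approximation. Left approximations and covariantly finite subcategories are defined dually. A complex $A^\bullet$ in $\mathcal A$ is right $\mathcal X$-acyclic if $\operatorname{Hom}_{\mathcal A}(X,A^\bullet)$ is acyclic for all $X\in\mathcal X$, and left $\mathcal X$-acyclic if $\operatorname{Hom}_{\mathcal A}(A^\bullet,X)$ is acyclic for all $X\in\mathcal X$. For $\mathcal X$ contravariantly finite, an $\mathcal X$-resolution of $M$ is a right $\mathcal X$-acyclic complex $\cdots\to X^{-1}\to X^0\to M\to 0$ with all $X^i\in\mathcal X$; the complex $X^\bullet=(\cdots\to X^{-1}\to X^0\to 0)$ is the deleted resolution. For $\mathcal Y$ covariantly finite, a $\mathcal Y$-coresolution of $N$ is a left $\mathcal Y$-acyclic complex $0\to N\to Y^0\to Y^1\to\cdots$ with all $Y^i\in\mathcal Y$. A pair $(\mathcal X,\mathcal Y)$ of subcategories is a balanced pair if $\mathcal X$ is contravariantly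 finite, $\mathcal Y$ is covariantly finite, every $M\in\mathcal A$ has an $\mathcal X$-resolution that is left $\mathcal Y$-acyclic, and every $N\in\mathcal A$ has a $\mathcal Y$-coresolution that is right $\mathcal X$-acyclic. In that case a complex is right $\mathcal X$-acyclic if and only if it is left $\mathcal Y$-acyclic; such complexes are called $\ast$-acyclic. The balanced pair is admissible if every right $\mathcal X$-approximation is an epimorphism (equivalently, every left $\mathcal Y$-approximation is a monomorphism). For $M,N\in\mathcal A$ put $\operatorname{Ext}_\ast^i(M,N):=H^i(\operatorname{Hom}_{\mathcal A}(X^\bullet,N))\cong H^i(\operatorname{Hom}_{\mathcal A}(M,Y^\bullet))$, where $X^\bullet\to M$ is an $\mathcal X$-resolution and $N\to Y^\bullet$ a $\mathcal Y$-coresolution (independent of choices). A pair $(\mathcal C,\mathcal D)$ of subcategories is a cotorsion pair relative to $(\mathcal X,\mathcal Y)$ if $\mathcal C=\{C\in\mathcal A\mid \operatorname{Ext}^1_\ast(C,D)=0\ \forall D\in\mathcal D\}$ and $\mathcal D=\{D\in\mathcal A\mid \operatorname{Ext}^1_\ast(C,D)=0\ \forall C\in\mathcal C\}$. It has enough projectives if for every $M\in\mathcal A$ there is a $\ast$-acyclic complex $0\to D\to C\to M\to 0$ with $C\in\mathcal C$, $D\in\mathcal D$; it has enough injectives if for every $M\in\mathcal A$ there is a $\ast$-acyclic complex $0\to M\to D\to C\to 0$ with $C\in\mathcal C$, $D\in\mathcal D$. *)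

(* Defs.v *)
From HB Require Import structures.
From mathcomp Require Import all_boot all_order all_algebra.
From mathcomp Require Import boolp.
Set Implicit Arguments.
Unset Strict Implicit.
Unset Printing Implicit Defensive.
Import Order.TTheory GRing.Theory Num.Theory.
Local Open Scope ring_scope.

Reserved Notation "g \c f" (at level 40, left associativity).

(* Hom-sets are MathComp abelian groups; the choiceType part of zmodType is   *)
(* no restriction in the presence of classical choice (boolp).                *)
Record preadditive := Preadditive {
  obj :> Type;
  mor : obj -> obj -> zmodType;
  idmap : forall A, mor A A;
  compm : forall A B C, mor B C -> mor A B -> mor A C;
  compmA : forall A B C D (h : mor C D) (g : mor B C) (f : mor A B),
    compm h (compm g f) = compm (compm h g) f;
  comp1m : forall A B (f : mor A B), compm (idmap B) f = f;
  compm1 : forall A B (f : mor A B), compm f (idmap A) = f;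
  compDl : forall A B C (g1 g2 : mor B C) (f : mor A B),
    compm (g1 + g2) f = compm g1 f + compm g2 f;
  compDr : forall A B C (g : mor B C) (f1 f2 : mor A B),
    compm g (f1 + f2) = compm g f1 + compm g f2
}.

Arguments mor {p} A B.
Arguments idmap {p} A.
Notation "g \c f" := (compm g f) : ring_scope.

Section Preadditive.
Variable P : preadditive.
Implicit Types A B C K Q S Z : P.

Definition monomorphism B C (g : mor B C) :=
  forall A (f1 f2 : mor A B), g \c f1 = g \c f2 -> f1 = f2.

Definition epimorphism A B (f : mor A B) :=
  forall C (g1 g2 : mor B C), g1 \c f = g2 \c f -> g1 = g2.

Definition isomorphic A B :=
  exists (f : mor A B) (g : mor B A), g \c f = idmap A /\ f \c g = idmap B.

Definition is_zero_object Z :=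
  (forall A (f : mor A Z), f = 0) /\ (forall A (f : mor Z A), f = 0).

Definition is_biproduct A B S := exists (i1 : mor A S) (i2 : mor B S)
    (p1 : mor S A) (p2 : mor S B),
  [/\ p1 \c i1 = idmap A, p2 \c i2 = idmap B, p1 \c i2 = 0, p2 \c i1 = 0
    & i1 \c p1 + i2 \c p2 = idmap S].

Definition is_kernel K A B (k : mor K A) (f : mor A B) :=
  f \c k = 0 /\
  forall S (g : mor S A), f \c g = 0 -> exists! h : mor S K, k \c h = g.

Definition is_cokernel A B Q (q : mor B Q) (f : mor A B) :=
  q \c f = 0 /\
  forall S (g : mor B S), g \c f = 0 -> exists! h : mor Q S, h \c q = g.

Lemma comp0m A B C (f : mor A B) : (0 : mor B C) \c f = 0.
Proof. by apply: (addrI (0 \c f)); rewrite -compDl !addr0. Qed.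

Lemma compm0 A B C (g : mor B C) : g \c (0 : mor A B) = 0.
Proof. by apply: (addrI (g \c 0)); rewrite -compDr !addr0. Qed.

Definition postcomp A B C (g : mor B C) (f : mor A B) : mor A C := g \c f.
Definition precomp A B C (f : mor A B) (g : mor B C) : mor A C := g \c f.

Lemma postcomp_nmod_morphism A B C (g : mor B C) :
  nmod_morphism (@postcomp A B C g).
Proof. by split=> [|f1 f2]; [exact: compm0 | exact: compDr]. Qed.

Lemma precomp_nmod_morphism A B C (f : mor A B) :
  nmod_morphism (@precomp A B C f).
Proof. by split=> [|g1 g2]; [exact: comp0m | exact: compDl]. Qed.

HB.instance Definition _ A B C (g : mor B C) :=
  GRing.isNmodMorphism.Build (mor A B) (mor A C) (@postcomp A B C g)
    (postcomp_nmod_morphism A g).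

HB.instance Definition _ A B C (f : mor A B) :=
  GRing.isNmodMorphism.Build (mor B C) (mor A C) (@precomp A B C f)
    (precomp_nmod_morphism C f).

End Preadditive.

Record abelian_category := AbelianCategory {
  abelian_base :> preadditive;
  zero_object : abelian_base;
  zero_objectP : is_zero_object zero_object;
  biproducts : forall A B : abelian_base, exists S, is_biproduct A B S;
  kernels : forall (A B : abelian_base) (f : mor A B),
    exists K (k : mor K A), is_kernel k f;
  cokernels : forall (A B : abelian_base) (f : mor A B),
    exists Q (q : mor B Q), is_cokernel q f;
  monic_kernel : forall (A B : abelian_base) (f : mor A B),
    monomorphism f -> exists C (g : mor B C), is_kernel f g;
  epic_cokernel : forall (A B : abelian_base) (f : mor A B),
    epimorphism f -> exists C (g : mor C A), is_cokernel f g
}.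

Arguments zero_object {a}.

Record subcategory (A : abelian_category) := Subcategory {
  mem_sub :> A -> Prop;
  sub_zero : mem_sub zero_object;
  sub_biproduct : forall S T Q : A,
    is_biproduct S T Q -> mem_sub S -> mem_sub T -> mem_sub Q;
  sub_iso : forall S T : A, isomorphic S T -> mem_sub S -> mem_sub T;
  sub_summand : forall S T Q : A, is_biproduct S T Q -> mem_sub Q -> mem_sub S
}.

(* Cochain complexes of abelian groups. The differential is given between all *)
(* pairs of degrees and vanishes except from i to i + 1; this avoids casts    *)
(* along equalities of degrees.                                               *)
Record zcomplex := ZComplex {
  zterm :> int -> zmodType;
  zdiff : forall i j, {additive zterm i -> zterm j};
  zdiff_shape : forall i j, j != i + 1 -> forall x, zdiff i j x = 0;
  zdiff_comp : forall i j k x, zdiff j k (zdiff i j x) = 0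
}.

Section Cohomology.
Variables (G : zcomplex) (n : int).

Definition cocycle_pred : {pred G n} := fun x => zdiff G n (n + 1) x == 0.

Lemma cocycle_zmod_closed : zmod_closed cocycle_pred.
Proof.
split=> [|x y]; rewrite !unfold_in /cocycle_pred ?raddf0 //.
by move=> /eqP dx /eqP dy; rewrite raddfB dx dy subr0.
Qed.

HB.instance Definition _ :=
  GRing.isZmodClosed.Build (G n) cocycle_pred cocycle_zmod_closed.

Record cocycle := Cocycle { cocycle_val : G n; _ : cocycle_val \in cocycle_pred }.

HB.instance Definition _ := [isSub for cocycle_val].
HB.instance Definition _ := [Choice of cocycle by <:].
HB.instance Definition _ := [SubChoice_isSubZmodule of cocycle by <:].

Definition coboundary_pred : {pred cocycle} :=
  fun x => `[< exists y : G (n - 1), zdiff G (n - 1) n y = val x >].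

Lemma coboundary_zmod_closed : zmod_closed coboundary_pred.
Proof.
split=> [|x y]; rewrite !unfold_in /coboundary_pred.
  by apply/asboolP; exists 0; rewrite !raddf0.
move=> /asboolP[u du] /asboolP[v dv]; apply/asboolP.
by exists (u - v); rewrite !raddfB du dv.
Qed.

HB.instance Definition _ :=
  GRing.isZmodClosed.Build cocycle coboundary_pred coboundary_zmod_closed.

Definition cohomology : zmodType := Quotient.quot coboundary_pred.

Lemma cohomology_eq0P : (forall e : cohomology, e = 0) <->
  (forall x : G n, zdiff G n (n + 1) x = 0 ->
     exists y : G (n - 1), zdiff G (n - 1) n y = x).
Proof.
split=> [H x /eqP dx | H e].
  pose c := Cocycle (dx : x \in cocycle_pred).
  have /eqP := H (\pi_(Quotient.quot coboundary_pred)%qT c).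
  rewrite -(raddf0 (\pi_(Quotient.quot coboundary_pred)%qT)).
  rewrite -Quotient.idealrBE subr0 => /asboolP[y dy].
  by exists y; rewrite dy.
rewrite -[e](@generic_quotient.reprK _ (Quotient.quot coboundary_pred)).
case: (generic_quotient.repr e) => x cx; apply/eqP.
rewrite -(raddf0 (\pi_(Quotient.quot coboundary_pred)%qT)).
rewrite -Quotient.idealrBE subr0; apply/asboolP => /=.
by have [y dy] := H x (eqP cx); exists y.
Qed.

End Cohomology.

Definition acyclic (G : zcomplex) := forall n (e : cohomology G n), e = 0.

Section Complexes.
Variable A : abelian_category.

Record complex := Complex {
  term :> int -> A;
  diff : forall i j, mor (term i) (term j);
  diff_shape : forall i j, j != i + 1 -> diff i j = 0;
  diff_comp : forall i j k, diff j k \c diff i j = 0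
}.

(* The cochain complex Hom(T, K), with Hom(T, K^n) in degree n.               *)
Section HomFrom.
Variables (T : A) (K : complex).

Lemma hom_from_shape i j : j != i + 1 ->
  forall x : mor T (K i), postcomp (diff K i j) x = 0.
Proof. by move=> ij x; rewrite /postcomp diff_shape // comp0m. Qed.

Lemma hom_from_comp i j k (x : mor T (K i)) :
  postcomp (diff K j k) (postcomp (diff K i j) x) = 0.
Proof. by rewrite /postcomp compmA diff_comp comp0m. Qed.

Definition hom_from : zcomplex :=
  @ZComplex (fun n => mor T (K n)) (fun i j => @postcomp A T _ _ (diff K i j))
    hom_from_shape hom_from_comp.
End HomFrom.

(* The cochain complex Hom(K, T), with Hom(K^{-n}, T) in degree n.            *)
Section HomTo.
Variables (K : complex) (T : A).

Lemma hom_to_shape i j : j != i + 1 ->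
  forall x : mor (K (- i)) T, precomp (diff K (- j) (- i)) x = 0.
Proof.
move=> ij x; rewrite /precomp diff_shape ?compm0 //.
by apply: contra ij => /eqP ji; rewrite -(opprK i) ji opprD opprK subrK.
Qed.

Lemma hom_to_comp i j k (x : mor (K (- i)) T) :
  precomp (diff K (- k) (- j)) (precomp (diff K (- j) (- i)) x) = 0.
Proof. by rewrite /precomp -compmA diff_comp compm0. Qed.

Definition hom_to : zcomplex :=
  @ZComplex (fun n => mor (K (- n)) T)
    (fun i j => @precomp A _ _ T (diff K (- j) (- i)))
    hom_to_shape hom_to_comp.
End HomTo.

(* Brutal truncation: the terms of K in degrees <= 0, and 0 in degrees > 0.   *)
Section Truncation.
Variable K : complex.

Definition trunc_term (i : int) : A := if i <= 0 then K i else zero_object.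

Definition trunc_diff i j : mor (trunc_term i) (trunc_term j) :=
  match i <= 0 as a, j <= 0 as b return
    mor (if a then K i else zero_object) (if b then K j else zero_object)
  with
  | true, true => diff K i j
  | _, _ => 0
  end.

Lemma trunc_diff_shape i j : j != i + 1 -> trunc_diff i j = 0.
Proof.
rewrite /trunc_diff /trunc_term => ij.
by case: (i <= 0); case: (j <= 0); rewrite ?diff_shape.
Qed.

Lemma trunc_diff_comp i j k : trunc_diff j k \c trunc_diff i j = 0.
Proof.
rewrite /trunc_diff /trunc_term.
by case: (i <= 0); case: (j <= 0); case: (k <= 0);
  rewrite ?diff_comp ?compm0 ?comp0m.
Qed.

Definition truncation := Complex trunc_diff_shape trunc_diff_comp.
End Truncation.

Implicit Types (X Y C D : subcategory A) (K : complex) (M N : A).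

Definition right_approximation X M (P : A) (f : mor P M) :=
  X P /\ forall P' : A, X P' ->
    forall g : mor P' M, exists h : mor P' P, f \c h = g.

Definition left_approximation Y N (Q : A) (f : mor N Q) :=
  Y Q /\ forall Q' : A, Y Q' ->
    forall g : mor N Q', exists h : mor Q Q', h \c f = g.

Definition contravariantly_finite X :=
  forall M, exists P (f : mor P M), right_approximation X f.

Definition covariantly_finite Y :=
  forall N, exists Q (f : mor N Q), left_approximation Y f.

Definition right_acyclic X K := forall P : A, X P -> acyclic (hom_from P K).

Definition left_acyclic Y K := forall Q : A, Y Q -> acyclic (hom_to K Q).

(* ... -> X^{-1} -> X^0 -> M -> 0, where M sits in degree 1.                  *)
Definition is_resolution X K M :=
  [/\ right_acyclic X K, forall i, i <= 0 -> X (K i), K 1 = M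
    & forall i, 1 < i -> is_zero_object (K i)].

(* 0 -> N -> Y^0 -> Y^1 -> ..., where N sits in degree -1.                    *)
Definition is_coresolution Y K N :=
  [/\ left_acyclic Y K, forall i, 0 <= i -> Y (K i), K (- 1) = N
    & forall i, i < - 1 -> is_zero_object (K i)].

Definition balanced_pair X Y :=
  [/\ contravariantly_finite X,
      covariantly_finite Y,
      forall M, exists2 K, is_resolution X K M & left_acyclic Y K
    & forall N, exists2 K, is_coresolution Y K N & right_acyclic X K].

Definition admissible_balanced_pair X Y :=
  balanced_pair X Y /\
  forall M (P : A) (f : mor P M), right_approximation X f -> epimorphism f.

(* For a balanced pair the two conditions are equivalent.                     *)
Definition star_acyclic X Y K := right_acyclic X K /\ left_acyclic Y K.

(* Ext_*^n(M, N) computed from an X-resolution K of M, the truncation of K    *)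
(* being the deleted resolution.                                              *)
Definition Ext K N n : zmodType := cohomology (hom_to (truncation K) N) n.

(* Ext_*^n(M, N) = 0; Ext does not depend on the resolution up to             *)
(* isomorphism, so every resolution of M is allowed.                          *)
Definition Ext_eq0 X n M N :=
  forall K, is_resolution X K M -> forall e : Ext K N n, e = 0.

Definition relative_cotorsion_pair X C D :=
  (forall M, C M <-> forall N, D N -> Ext_eq0 X 1 M N) /\
  (forall N, D N <-> forall M, C M -> Ext_eq0 X 1 M N).

(* K is the complex 0 -> L -> M -> N -> 0 placed in degrees 0, 1, 2.          *)
Definition short_complex K (L M N : A) :=
  [/\ K 0 = L, K 1 = M, K 2 = N
    & forall i, (i < 0) || (2 < i) -> is_zero_object (K i)].

Definition enough_projectives X Y C D :=
  forall M, exists K (S T : A),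
    [/\ short_complex K T S M, star_acyclic X Y K, C S & D T].

Definition enough_injectives X Y C D :=
  forall M, exists K (S T : A),
    [/\ short_complex K M T S, star_acyclic X Y K, C S & D T].

End Complexes.

(* Main.v *)
From mathcomp Require Import all_boot all_algebra.
Require Import Defs.
Set Implicit Arguments.
Unset Strict Implicit.
Unset Printing Implicit Defensive.
Import GRing.Theory.
Local Open Scope ring_scope.

(** The theorem is Salce's lemma for the exact structure on the abelian category
    whose conflations are the short exact sequences [R -> S -> T] that stay
    exact under [Hom(P, -)] for [P] in [X] and under [Hom(-, Q)] for [Q] in [Y].
    In it the objects of [X] are projective and those of [Y] are injective, and
    there are enough of both ([admissible_enough_X], [admissible_enough_Y]).

    Suppose that [(C, D)] has enough projectives, and let [M] be an object.
    Choose conflations [M -> I -> L] with [I] in [Y] and [T -> S -> L] with [S]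
    in [C] and [T] in [D], and let [E] be the pullback of [I -> L <- S]. Both
    [T -> E -> I] and [M -> E -> S] are conflations ([pullback_conflation]).
    As [T] and [I] lie in [D] and [Ext^1(W, -)] is half exact, [E] lies in [D],
    so that [M -> E -> S] is the required sequence ([salce]). The converse is
    the same statement in the opposite category ([salce_dual]).

    No long exact sequence is needed: the vanishing of [Ext^1(M, N)] says that,
    for a conflation [Z -> P -> M] with [P] in [X], each morphism [Z -> N]
    extends to [P], and then half exactness is a short diagram chase
    ([ext_vanishes_extension]). The vanishing computed dually from a conflation
    [N -> Q -> L] with [Q] in [Y] is equivalent to it ([ext_coext_vanishes],
    [coext_ext_vanishes]), which is what makes the situation self-dual.

    Admissibility enters through the fact that every object [M] receives an
    epimorphism from an object of [X]. Hence complexes that are exact under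
    [Hom(P, -)] for [P] in [X] are exact, which relates the conditions on
    complexes to conflations ([star_acyclic_conflation], [Ext_eq0_vanishes]). *)

(** * Monomorphisms, epimorphisms and kernels *)

Section Preadditive.
Variable P : preadditive.

Lemma compmN (A B C : P) (g : mor B C) (f : mor A B) : g \c (- f) = - (g \c f).
Proof. by apply: (addrI (g \c f)); rewrite -compDr !subrr compm0. Qed.

Lemma compNm (A B C : P) (g : mor B C) (f : mor A B) : (- g) \c f = - (g \c f).
Proof. by apply: (addrI (g \c f)); rewrite -compDl !subrr comp0m. Qed.

Lemma compBr (A B C : P) (g : mor B C) (f1 f2 : mor A B) :
  g \c (f1 - f2) = g \c f1 - g \c f2.
Proof. by rewrite compDr compmN. Qed.

Lemma compBl (A B C : P) (g1 g2 : mor B C) (f : mor A B) :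
  (g1 - g2) \c f = g1 \c f - g2 \c f.
Proof. by rewrite compDl compNm. Qed.

Lemma mono_eq0 (A B C : P) (g : mor B C) (f : mor A B) :
  monomorphism g -> g \c f = 0 -> f = 0.
Proof. by move=> mg gf; apply: mg; rewrite gf compm0. Qed.

Lemma epi_eq0 (A B C : P) (g : mor B C) (f : mor A B) :
  epimorphism f -> g \c f = 0 -> g = 0.
Proof. by move=> ef gf; apply: ef; rewrite gf comp0m. Qed.

Lemma monomorphism0 (A B : P) (f : mor A B) :
  (forall C (g : mor C A), f \c g = 0 -> g = 0) -> monomorphism f.
Proof.
move=> mf C g1 g2 e; apply/eqP; rewrite -subr_eq0; apply/eqP/mf.
by rewrite compBr e subrr.
Qed.

Lemma is_kernel_mono (K A B : P) (k : mor K A) (f : mor A B) :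
  is_kernel k f -> monomorphism k.
Proof.
case=> fk uk S g1 g2 e; have [|h [_ uh]] := uk S (k \c g1).
  by rewrite compmA fk comp0m.
by rewrite -(uh g1) // -(uh g2).
Qed.

Lemma is_kernel_lift (K A B S : P) (k : mor K A) (f : mor A B) (g : mor S A) :
  is_kernel k f -> f \c g = 0 -> exists h, k \c h = g.
Proof. by case=> _ uk /uk[h [? _]]; exists h. Qed.

Lemma is_cokernel_epi (A B Q : P) (q : mor B Q) (f : mor A B) :
  is_cokernel q f -> epimorphism q.
Proof.
case=> qf uq S g1 g2 e; have [|h [_ uh]] := uq S (g1 \c q).
  by rewrite -compmA qf compm0.
by rewrite -(uh g1) // -(uh g2).
Qed.

Lemma is_cokernel_desc (A B Q S : P) (q : mor B Q) (f : mor A B)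
    (g : mor B S) : is_cokernel q f -> g \c f = 0 -> exists h, h \c q = g.
Proof. by case=> _ uq /uq[h [? _]]; exists h. Qed.

End Preadditive.

(** * The opposite category *)

(** Same objects, with the morphisms reversed. *)
Definition op_preadditive (P : preadditive) : preadditive :=
  @Preadditive (obj P) (fun A B => mor B A) (@idmap P)
    (fun A B C g f => f \c g)
    (fun A B C D h g f => esym (compmA f g h))
    (fun A B f => compm1 f) (fun A B f => comp1m f)
    (fun A B C g1 g2 f => compDr f g1 g2)
    (fun A B C g f1 f2 => compDl f1 f2 g).

Section Opposite.
Variable A : abelian_category.

Lemma op_zero_objectP : @is_zero_object (op_preadditive A) zero_object.
Proof.
by have [z0 z1] := zero_objectP A; split=> B f; [exact: z1 | exact: z0].
Qed.

Lemma op_biproducts (S T : op_preadditive A) : exists Q, is_biproduct S T Q.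
Proof.
have [Q [i1 [i2 [p1 [p2 [e1 e2 e3 e4 e5]]]]]] := @biproducts A S T.
by exists Q, p1, p2, i1, i2.
Qed.

(** Kernels and cokernels are exchanged, as are monomorphisms and
    epimorphisms; biproducts and zero objects are self-dual. *)
Definition op_abelian : abelian_category :=
  @AbelianCategory (op_preadditive A) zero_object op_zero_objectP op_biproducts
    (fun S T f => @cokernels A T S f) (fun S T f => @kernels A T S f)
    (fun S T f => @epic_cokernel A T S f) (fun S T f => @monic_kernel A T S f).

End Opposite.

(** * Conflations and relative extensions *)

Section Conflations.
Variable A : abelian_category.
Implicit Types X Y C D : A -> Prop.

Lemma epi_cokernel_kernel (K S T : A) (k : mor K S) (f : mor S T) :
  is_kernel k f -> epimorphism f -> is_cokernel f k.
Proof.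
move=> kf ef; split=> [|Q g gk]; first by case: kf.
have [C [c cf]] := epic_cokernel ef.
have [c' kc'] := is_kernel_lift kf (proj1 cf).
have [|h hf] := is_cokernel_desc (g := g) cf.
  by rewrite -kc' compmA gk comp0m.
by exists h; split=> // h' h'f; apply: ef; rewrite hf.
Qed.

(** Every morphism from an object of [X] to the target of [f] factors through
    [f]; when the source of [f] lies in [X], this says that [f] is a right
    [X]-approximation. *)
Definition lifting X (S T : A) (f : mor S T) :=
  forall P, X P -> forall g : mor P T, exists h, f \c h = g.

(** The dual condition. *)
Definition extending Y (S T : A) (k : mor S T) :=
  forall Q, Y Q -> forall g : mor S Q, exists h, h \c k = g.

(** For [R -> S -> T] with zero composite, exactness at [Hom(P, S)] of the image
    of this sequence under every [Hom(P, -)] with [P] in [X]. *)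
Definition exact_on X (R S T : A) (k : mor R S) (f : mor S T) :=
  forall P, X P -> forall g : mor P S, f \c g = 0 -> exists h, k \c h = g.

(** Every object is a quotient of an object of [X]. *)
Definition generating X :=
  forall M, exists P (p : mor P M), X P /\ epimorphism p.

Lemma lifting_epi X (S T : A) (f : mor S T) :
  generating X -> lifting X f -> epimorphism f.
Proof.
move=> gX lf Q g1 g2 e; have [P [p [XP ep]]] := gX T.
by have [h fh] := lf P XP p; apply: ep; rewrite -fh !compmA e.
Qed.

(** If [p : P -> R] is epi with [P] in [X] and [g : R -> S] is killed by [f],
    then [g \c p] factors through [k], and the factor descends along [p]. *)
Lemma exact_on_kernel X (K S T : A) (k : mor K S) (f : mor S T) :
  generating X -> f \c k = 0 -> exact_on X k f -> monomorphism k ->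
  is_kernel k f.
Proof.
move=> gX fk ex mk; split=> // R g fg.
have [P [p [XP ep]]] := gX R.
have [|h kh] := ex P XP (g \c p); first by rewrite compmA fg comp0m.
have [W [c cp]] := epic_cokernel ep.
have [|h' h'p] := is_cokernel_desc (g := h) cp.
  apply: (mono_eq0 mk); rewrite compmA kh -compmA.
  by case: cp => -> _; rewrite compm0.
have kh' : k \c h' = g by apply: ep; rewrite -compmA h'p.
by exists h'; split=> // h'' e; apply: mk; rewrite kh'.
Qed.

(** The short exact sequences that stay exact under [Hom(P, -)] for [P] in [X]
    and under [Hom(-, Q)] for [Q] in [Y]. *)
Definition conflation X Y (R S T : A) (k : mor R S) (f : mor S T) :=
  [/\ is_kernel k f, is_cokernel f k, lifting X f & extending Y k].

Lemma mono_of_generating X (R S : A) (k : mor R S) : generating X ->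
  (forall P, X P -> forall h : mor P R, k \c h = 0 -> h = 0) -> monomorphism k.
Proof.
move=> gX mk; apply: monomorphism0 => W a ka.
have [P [p [XP ep]]] := gX W.
by apply: (epi_eq0 ep); apply: mk => //; rewrite compmA ka comp0m.
Qed.

(** The map from [P1] to the kernel of [p] is epi, because an epimorphism
    onto that kernel from an object of [X] factors through it. *)
Lemma syzygy_epi X (P1 P0 M Z : A) (d : mor P1 P0) (p : mor P0 M)
    (i : mor Z P0) :
  generating X -> p \c d = 0 -> exact_on X d p -> is_kernel i p ->
  exists2 e, i \c e = d & epimorphism e.
Proof.
move=> gX pd ex ip; have [e ie] := is_kernel_lift ip pd.
exists e => //; have [P [q [XP eq]]] := gX Z.
have [|h dh] := ex P XP (i \c q).
  by rewrite compmA; case: ip => -> _; rewrite comp0m.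
have eh : e \c h = q by apply: (is_kernel_mono ip); rewrite compmA ie.
by move=> Q g1 g2 e12; apply: eq; rewrite -eh !compmA e12.
Qed.

(** If [P2 -> P1 -> P0 -> M] is the end of an [X]-resolution that is exact at
    [P1] under [Hom(-, Q)] for [Q] in [Y], then the kernel of [P0 -> M] is the
    first term of a conflation: a morphism from it to [Q] is tested on [P1]. *)
Lemma syzygy_conflation X Y (P2 P1 P0 M : A) (d' : mor P2 P1) (d : mor P1 P0)
    (p : mor P0 M) :
  generating X -> d \c d' = 0 -> p \c d = 0 -> exact_on X d p ->
  lifting X p ->
  (forall Q, Y Q -> forall u : mor P1 Q,
    u \c d' = 0 -> exists v, v \c d = u) ->
  exists Z (i : mor Z P0), conflation X Y i p.
Proof.
move=> gX dd' pd ex lp Hd; have [Z [i ip]] := kernels p.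
have [e ie ee] := syzygy_epi gX pd ex ip.
exists Z, i; split=> //.
  exact: epi_cokernel_kernel ip (lifting_epi gX lp).
move=> Q YQ t; have [|v vd] := Hd Q YQ (t \c e).
  have ed' : e \c d' = 0.
    by apply: (mono_eq0 (is_kernel_mono ip)); rewrite compmA ie.
  by rewrite -compmA ed' compm0.
by exists v; apply: ee; rewrite -compmA ie.
Qed.

(** Every object is the end of a conflation with middle term in [X]. *)
Definition enough_X_conflations X Y :=
  forall M, exists Z P (i : mor Z P) (p : mor P M), X P /\ conflation X Y i p.

(** Every object is the beginning of a conflation with middle term in [Y]. *)
Definition enough_Y_conflations X Y :=
  forall N, exists Q L (n : mor N Q) (q : mor Q L), Y Q /\ conflation X Y n q.

Lemma enough_X_conflations_generating X Y :
  enough_X_conflations X Y -> generating X.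
Proof.
move=> eX M; have [Z [P [i [p [XP [_ cp _ _]]]]]] := eX M.
by exists P, p; split=> //; apply: is_cokernel_epi cp.
Qed.

(** The relative [Ext^1(M, N)] vanishes: for every conflation [Z -> P -> M] with
    [P] in [X], each morphism [Z -> N] extends to [P]. *)
Definition ext_vanishes X Y M N :=
  forall Z P (i : mor Z P) (p : mor P M), X P -> conflation X Y i p ->
  forall t : mor Z N, exists v, v \c i = t.

(** The same condition computed from [N]: for every conflation [N -> Q -> L]
    with [Q] in [Y], each morphism [M -> L] lifts to [Q]. *)
Definition coext_vanishes X Y M N :=
  forall Q L (n : mor N Q) (q : mor Q L), Y Q -> conflation X Y n q ->
  forall t : mor M L, exists v, q \c v = t.

Lemma ext_coext_vanishes X Y M N : enough_X_conflations X Y ->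
  ext_vanishes X Y M N -> coext_vanishes X Y M N.
Proof.
move=> eX ext Q L n q YQ [nq cq lq _] h.
have [Z [P [i [p [XP cf]]]]] := eX M.
have [w qw] := lq P XP (h \c p).
have [ip cp _ _] := cf.
have [|t nt] := is_kernel_lift (g := w \c i) nq.
  by rewrite compmA qw -compmA (proj1 ip) compm0.
have [t' t'i] := ext _ _ _ _ XP cf t.
have [|h' h'p] := is_cokernel_desc (g := w - n \c t') cp.
  by rewrite compBl -compmA t'i nt subrr.
exists h'; apply: (is_cokernel_epi cp).
by rewrite -compmA h'p compBr compmA (proj1 nq) comp0m subr0.
Qed.

Lemma coext_ext_vanishes X Y M N : enough_Y_conflations X Y ->
  coext_vanishes X Y M N -> ext_vanishes X Y M N.
Proof.
move=> eY ext Z P i p XP [ip cp _ ei] t.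
have [Q [L [n [q [YQ cf]]]]] := eY N.
have [w wi] := ei Q YQ (n \c t).
have [nq cq _ _] := cf.
have [|h hp] := is_cokernel_desc (g := q \c w) cp.
  by rewrite -compmA wi compmA (proj1 nq) comp0m.
have [h' qh'] := ext _ _ _ _ YQ cf h.
have [|t' nt'] := is_kernel_lift (g := w - h' \c p) nq.
  by rewrite compBr compmA qh' hp subrr.
exists t'; apply: (is_kernel_mono nq).
by rewrite compmA nt' compBl -compmA (proj1 ip) compm0 subr0.
Qed.

(** Schanuel's argument: whether all morphisms to [N] from the kernel of a right
    [X]-approximation of [M] extend does not depend on the approximation. Only
    the lifting property is required of the two approximations. *)
Lemma syzygy_extension_independent X (M N Z P Z' P' : A) (i : mor Z P)
    (p : mor P M) (i' : mor Z' P') (p' : mor P' M) :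
  X P -> X P' -> is_kernel i p -> is_kernel i' p' -> lifting X p ->
  lifting X p' ->
  (forall t : mor Z N, exists v, v \c i = t) ->
  forall t : mor Z' N, exists v, v \c i' = t.
Proof.
move=> XP XP' ip ip' lp lp' ext t.
have [a pa] := lp' P XP p; have [b pb] := lp P' XP' p'.
have [|s is'] := is_kernel_lift (g := idmap P' - a \c b) ip'.
  by rewrite compBr compm1 compmA pa pb subrr.
have [|al ial] := is_kernel_lift (g := a \c i) ip'.
  by rewrite compmA pa (proj1 ip).
have [|be ibe] := is_kernel_lift (g := b \c i') ip.
  by rewrite compmA pb (proj1 ip').
have [v vi] := ext (t \c al).
have alb : al \c be + s \c i' = idmap Z'.
  apply: (is_kernel_mono ip'); rewrite compDr !compmA ial is' compBl comp1m.
  by rewrite -!compmA ibe compm1 addrC subrK.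
exists (v \c b + t \c s).
by rewrite compDl -!compmA -ibe compmA vi -!compmA -compDr alb compm1.
Qed.

(** * Pullbacks of conflations *)

Definition is_pullback (B C L P : A) (f : mor B L) (g : mor C L)
    (a : mor P B) (b : mor P C) :=
  [/\ f \c a = g \c b,
      forall T (x : mor T B) (y : mor T C), f \c x = g \c y ->
        exists2 h, a \c h = x & b \c h = y
    & forall T (h1 h2 : mor T P),
        a \c h1 = a \c h2 -> b \c h1 = b \c h2 -> h1 = h2].

Lemma is_pullback_sym (B C L P : A) (f : mor B L) (g : mor C L)
    (a : mor P B) (b : mor P C) : is_pullback f g a b -> is_pullback g f b a.
Proof.
case=> e l u; split=> // [T x y /esym/l[h ? ?]|T h1 h2 e1 e2].
  by exists h.
exact: u.
Qed.

(** The pullback is the kernel of [f \c p1 - g \c p2] on a biproduct. *)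
Lemma pullback_exists (B C L : A) (f : mor B L) (g : mor C L) :
  exists P (a : mor P B) (b : mor P C), is_pullback f g a b.
Proof.
have [S [i1 [i2 [p1 [p2 [e11 e22 e12 e21 eS]]]]]] := biproducts B C.
have [P [k kP]] := kernels (f \c p1 - g \c p2).
exists P, (p1 \c k), (p2 \c k); split.
- by apply/eqP; rewrite -subr_eq0 !compmA -compBl (proj1 kP).
- move=> T x y e; have [|h kh] := is_kernel_lift (g := i1 \c x + i2 \c y) kP.
    rewrite compDr !compBl -!compmA (compmA p1 i1) (compmA p2 i1).
    rewrite (compmA p1 i2) (compmA p2 i2) e11 e22 e12 e21.
    by rewrite !comp0m !comp1m !compm0 subr0 sub0r e subrr.
  exists h; rewrite -compmA kh compDr !compmA.
    by rewrite e11 e12 comp1m comp0m addr0.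
  by rewrite e22 e21 comp1m comp0m add0r.
- move=> T h1 h2 e1 e2; apply: (is_kernel_mono kP).
  by rewrite -[LHS]comp1m -[RHS]comp1m -eS !compDl -!compmA !(compmA _ k) e1 e2.
Qed.

(** Both defining properties of the pulled back sequence are inherited from
    [R -> S -> T]; that [b] is epi follows from the lifting property. *)
Lemma pullback_conflation X Y (R S T I P : A) (k : mor R S) (f : mor S T)
    (g : mor I T) (a : mor P S) (b : mor P I) :
  generating X -> is_pullback f g a b -> conflation X Y k f ->
  exists k' : mor R P, conflation X Y k' b.
Proof.
move=> gX [e l u] [kf cf lf ek].
have [|k' ak' bk'] := l _ k 0; first by rewrite (proj1 kf) compm0.
have kb : is_kernel k' b.
  split=> // W x bx; have [|h kh] := is_kernel_lift (g := a \c x) kf.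
    by rewrite compmA e -compmA bx compm0.
  have k'h : k' \c h = x.
    by apply: u; rewrite compmA ?ak' // bk' comp0m bx.
  exists h; split=> // h' e'; apply: (is_kernel_mono kf).
  by rewrite kh -ak' -compmA e'.
have lb : lifting X b.
  move=> Q XQ x; have [w fw] := lf Q XQ (g \c x).
  by have [h _ bh] := l _ _ _ fw; exists h.
exists k'; split=> //.
  exact: epi_cokernel_kernel kb (lifting_epi gX lb).
move=> Q YQ x; have [h hk] := ek Q YQ x.
by exists (h \c a); rewrite -compmA ak'.
Qed.

(** * Salce's lemma *)

Lemma ext_vanishes_Y X Y M N : Y N -> ext_vanishes X Y M N.
Proof. by move=> YN Z P i p XP [_ _ _ ei] t; apply: ei. Qed.

(** Half exactness of [Ext^1(M, -)] on conflations. *)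
Lemma ext_vanishes_extension X Y (M R S T : A) (k : mor R S) (f : mor S T) :
  conflation X Y k f -> ext_vanishes X Y M R -> ext_vanishes X Y M T ->
  ext_vanishes X Y M S.
Proof.
move=> [kf _ lf _] exR exT Z P i p XP cf g.
have [v vi] := exT _ _ _ _ XP cf (f \c g).
have [w fw] := lf P XP v.
have [|r kr] := is_kernel_lift (g := g - w \c i) kf.
  by rewrite compBr compmA fw vi subrr.
have [r' r'i] := exR _ _ _ _ XP cf r.
by exists (w + k \c r'); rewrite compDl -[k \c r' \c i]compmA r'i kr addrC subrK.
Qed.

(** The cotorsion pair has enough projectives, in terms of conflations. *)
Definition enough_proj_conflations X Y C D :=
  forall M, exists S T (k : mor T S) (f : mor S M),
    [/\ conflation X Y k f, C S & D T].

(** The cotorsion pair has enough injectives, in terms of conflations. *)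
Definition enough_inj_conflations X Y C D :=
  forall M, exists S T (k : mor M T) (f : mor T S),
    [/\ conflation X Y k f, C S & D T].

Lemma salce X Y C D :
  enough_X_conflations X Y -> enough_Y_conflations X Y ->
  (forall N, D N <-> forall M, C M -> ext_vanishes X Y M N) ->
  enough_proj_conflations X Y C D -> enough_inj_conflations X Y C D.
Proof.
move=> eX eY hD eP M.
have gX := enough_X_conflations_generating eX.
have [I [L [n [q [YI cq]]]]] := eY M.
have [S [T [k [f [cf CS DT]]]]] := eP L.
have [P [a [b pb]]] := pullback_exists f q.
have [k' ck'] := pullback_conflation gX pb cf.
have [n' cn'] := pullback_conflation gX (is_pullback_sym pb) cq.
exists S, P, n', a; split=> //; apply/hD => W CW.
apply: (ext_vanishes_extension ck'); first exact: (proj1 (hD T)).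
exact: ext_vanishes_Y.
Qed.

End Conflations.

Lemma op_conflation (A : abelian_category) (X Y : A -> Prop) (R S T : A)
    (k : mor R S) (f : mor S T) :
  conflation X Y k f -> @conflation (op_abelian A) Y X T S R f k.
Proof. by case=> kf cf lf ek; split. Qed.

Lemma op_conflationK (A : abelian_category) (X Y : A -> Prop) (R S T : A)
    (k : mor R S) (f : mor S T) :
  @conflation (op_abelian A) Y X T S R f k -> conflation X Y k f.
Proof. by case=> kf cf lf ek; split. Qed.

(** [salce] in the opposite category, where [X] and [Y], [C] and [D], and the two
    descriptions of the vanishing of [Ext^1] are exchanged. *)
Lemma salce_dual (A : abelian_category) (X Y C D : A -> Prop) :
  enough_X_conflations X Y -> enough_Y_conflations X Y ->
  (forall M, C M <-> forall N, D N -> coext_vanishes X Y M N) ->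
  enough_inj_conflations X Y C D -> enough_proj_conflations X Y C D.
Proof.
move=> eX eY hC eI M.
have eX' : @enough_X_conflations (op_abelian A) Y X.
  move=> N; have [Q [L [n [q [YQ cq]]]]] := eY N.
  by exists L, Q, q, n; split=> //; apply: op_conflation.
have eY' : @enough_Y_conflations (op_abelian A) Y X.
  move=> N; have [Z [P [i [p [XP cp]]]]] := eX N.
  by exists P, Z, p, i; split=> //; apply: op_conflation.
have hC' N : C N <-> forall W, D W -> @ext_vanishes (op_abelian A) Y X W N.
  rewrite hC; split=> H W DW.
    move=> L Q q n YQ /op_conflationK cq; exact: H cq.
  move=> Q L n q YQ /op_conflation cq; exact: H cq.
have eP' : @enough_proj_conflations (op_abelian A) Y X D C.
  move=> N; have [S [T [k [f [cf CS DT]]]]] := eI N.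
  by exists T, S, f, k; split=> //; apply: op_conflation.
have [T [S [k [f [cf DT CS]]]]] := salce eX' eY' hC' eP' M.
by exists S, T, f, k; split=> //; apply: op_conflationK.
Qed.

(** * Translation from complexes *)

Section Translation.
Variable A : abelian_category.
Implicit Types (X Y C D : subcategory A) (K : complex A) (M N : A).

Lemma right_acyclic_exact X K P n : right_acyclic X K -> X P ->
  forall g : mor P (K n), diff K n (n + 1) \c g = 0 ->
  exists h, diff K (n - 1) n \c h = g.
Proof. by move=> aK XP; have /cohomology_eq0P := aK P XP n. Qed.

Lemma left_acyclic_exact Y K Q n : left_acyclic Y K -> Y Q ->
  forall g : mor (K (- n)) Q, g \c diff K (- (n + 1)) (- n) = 0 ->
  exists h, h \c diff K (- n) (- (n - 1)) = g.
Proof. by move=> aK YQ; have /cohomology_eq0P := aK Q YQ n. Qed.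

(** The degrees -2, -1 and 0 that compute [Ext^1] are not affected by the
    truncation. *)
Lemma Ext1_eq0P K N :
  (forall e : Ext K N 1, e = 0) <->
  forall u : mor (K (- 1)) N, u \c diff K (- 2) (- 1) = 0 ->
    exists v, v \c diff K (- 1) 0 = u.
Proof. exact: cohomology_eq0P. Qed.

Lemma admissible_generating X Y : admissible_balanced_pair X Y -> generating X.
Proof.
move=> [[cX _ _ _] adm] M; have [P [f rf]] := cX M.
by exists P, f; split; [case: rf | exact: adm rf].
Qed.

Lemma resolution_exact X K M : is_resolution X K M ->
  [/\ exact_on X (diff K (- 2) (- 1)) (diff K (- 1) 0),
      exact_on X (diff K (- 1) 0) (diff K 0 1) & lifting X (diff K 0 1)].
Proof.
case=> aK XK _ zK; split.
- by move=> P XP g; apply: (@right_acyclic_exact X K P (- 1) aK XP g).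
- by move=> P XP g; apply: (@right_acyclic_exact X K P 0 aK XP g).
move=> P XP g; apply: (@right_acyclic_exact X K P 1 aK XP g).
exact: (proj1 (zK 2 isT)).
Qed.

Lemma admissible_enough_X X Y :
  admissible_balanced_pair X Y -> enough_X_conflations X Y.
Proof.
move=> adm M; have gX := admissible_generating adm.
case: adm => -[_ _ res _] _; have [K rK aK] := res M.
have [ex1 ex0 lK] := resolution_exact rK; case: rK => _ XK KM _; case: _ / KM.
have [|Z [i cf]] := syzygy_conflation (Y := Y) gX
  (diff_comp K (- 2) (- 1) 0) (diff_comp K (- 1) 0 1) ex0 lK.
  by move=> Q YQ u; apply: (@left_acyclic_exact Y K Q 1 aK YQ u).
by exists Z, (K 0), i, (diff K 0 1); split=> //; apply: XK.
Qed.

Lemma admissible_enough_Y X Y :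
  admissible_balanced_pair X Y -> enough_Y_conflations X Y.
Proof.
move=> adm; have gX := admissible_generating adm.
case: adm => -[_ _ _ cores] _.
(* A right [X]-acyclic coresolution begins with a monomorphism: the preceding
   term is zero, so [Hom(P, -)] makes its first map injective for [P] in [X],
   and [X] is generating. *)
have mono N K : is_coresolution Y K N -> right_acyclic X K ->
    monomorphism (diff K (- 1) 0).
  case=> _ _ _ zK aK; apply: (mono_of_generating gX) => P XP h e.
  have [y <-] := @right_acyclic_exact X K P (- 1) aK XP h e.
  by rewrite (proj1 (zK (- 1 - 1) isT) P y) compm0.
have gY : @generating (op_abelian A) Y.
  move=> N; have [K cK aK] := cores N; have mK := mono _ _ cK aK.
  case: cK => _ YK KN _; case: _ / KN.
  by exists (K 0), (diff K (- 1) 0); split; [apply: YK | exact: mK].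
move=> N; have [K cK aK] := cores N.
have [lK YK KN zK] := cK; case: _ / KN.
have ex : @exact_on (op_abelian A) Y _ _ _ (diff K 0 1) (diff K (- 1) 0).
  by move=> Q YQ g; apply: (@left_acyclic_exact Y K Q 0 lK YQ g).
have ext : @lifting (op_abelian A) Y _ _ (diff K (- 1) 0).
  move=> Q YQ g; apply: (@left_acyclic_exact Y K Q 1 lK YQ g).
  exact: (proj2 (zK (- 2) isT)).
have [|L [q cf]] := @syzygy_conflation (op_abelian A) Y X _ _ _ _
  (diff K 1 2) _ _ gY (diff_comp K 0 1 2) (diff_comp K (- 1) 0 1) ex ext.
  by move=> P XP u; apply: (@right_acyclic_exact X K P 1 aK XP u).
exists (K 0), L, (diff K (- 1) 0), q; split; first exact: YK.
exact: op_conflationK cf.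
Qed.

(** For a resolution [K], cocycles [K (- 1) -> N] correspond to morphisms to [N]
    from the kernel of [K 0 -> K 1], and coboundaries to those that extend to
    [K 0]; the choice of the approximation [K 0 -> K 1] is immaterial by
    [syzygy_extension_independent]. *)
Lemma Ext_eq0_vanishes X Y M N : admissible_balanced_pair X Y ->
  Ext_eq0 X 1 M N <-> ext_vanishes X Y M N.
Proof.
move=> adm; have gX := admissible_generating adm; split=> H.
  have [[_ _ res _] _] := adm; have [K rK aK] := res M.
  have [ex1 ex0 lK] := resolution_exact rK.
  have /Ext1_eq0P := H K rK => {}H.
  case: rK => _ XK KM _; case: _ / KM => Z P i p XP [ip _ lp _].
  have [Z' [i' ip']] := kernels (diff K 0 1).
  have [e ie ee] := syzygy_epi gX (@diff_comp A K _ _ _) ex0 ip'.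
  apply: (syzygy_extension_independent _ XP ip' ip lK lp); first exact: XK.
  move=> t; have [|v vd] := H (t \c e).
    have ed : e \c diff K (- 2) (- 1) = 0.
      by apply: (mono_eq0 (is_kernel_mono ip')); rewrite compmA ie diff_comp.
    by rewrite -compmA ed compm0.
  by exists v; apply: ee; rewrite -compmA ie.
move=> K rK; apply/Ext1_eq0P => u ud.
have [ex1 ex0 lK] := resolution_exact rK.
have [Z [P [i [p [XP cf]]]]] := admissible_enough_X adm M.
case: rK => _ XK KM _; case: _ / KM H p cf => H p cf.
have [Z' [i' ip']] := kernels (diff K 0 1).
have [e ie ee] := syzygy_epi gX (@diff_comp A K _ _ _) ex0 ip'.
have [W [c ce]] := epic_cokernel ee.
(* [u] kills the kernel of [e], as [Hom(P, -)] of the resolution is exact at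
   the term of degree -1 and [X] is generating. *)
have uc : u \c c = 0.
  have [P' [q [XP' eq]]] := gX W; apply: (epi_eq0 eq).
  have [|w dw] := ex1 P' XP' (c \c q).
    by rewrite -ie compmA -(compmA i') (proj1 ce) compm0 comp0m.
  by rewrite -compmA -dw compmA ud comp0m.
have [t te] := is_cokernel_desc ce uc.
have [ip _ lp _] := cf.
have [|v vi] := syzygy_extension_independent XP _ ip ip' lp lK
  (H _ _ _ _ XP cf) t; first exact: XK.
by exists v; rewrite -ie compmA vi.
Qed.

Lemma star_acyclic_conflation X Y K :
  generating X -> star_acyclic X Y K ->
  (forall i, (i < 0) || (2 < i) -> is_zero_object (K i)) ->
  conflation X Y (diff K 0 1) (diff K 1 2).
Proof.
move=> gX [rK lK] zK.
have lf : lifting X (diff K 1 2).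
  move=> P XP g; apply: (@right_acyclic_exact X K P 2 rK XP g).
  exact: (proj1 (zK 3 isT)).
have mk : monomorphism (diff K 0 1).
  apply: (mono_of_generating gX) => P XP h e.
  have [y <-] := @right_acyclic_exact X K P 0 rK XP h e.
  by rewrite (proj1 (zK (- 1) isT) P y) compm0.
have kf : is_kernel (diff K 0 1) (diff K 1 2).
  apply: (exact_on_kernel gX _ _ mk); first exact: diff_comp.
  by move=> P XP g; apply: (@right_acyclic_exact X K P 1 rK XP g).
split=> //; first exact: epi_cokernel_kernel kf (lifting_epi gX lf).
move=> Q YQ g; apply: (@left_acyclic_exact Y K Q 0 lK YQ g).
exact: (proj2 (zK (- 1) isT)).
Qed.

(** The complex [0 -> R -> S -> T -> 0] in degrees 0, 1 and 2. *)
Section ShortComplex.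
Variables (R S T : A) (k : mor R S) (f : mor S T).
Hypothesis fk : f \c k = 0.

Definition short_term (i : int) : A :=
  match i with
  | Posz 0 => R | Posz 1 => S | Posz 2 => T | _ => zero_object
  end.

Definition short_diff (i j : int) : mor (short_term i) (short_term j) :=
  match i as i, j as j return mor (short_term i) (short_term j) with
  | Posz 0, Posz 1 => k
  | Posz 1, Posz 2 => f
  | _, _ => 0
  end.

Lemma short_diff_shape i j : j != i + 1 -> short_diff i j = 0.
Proof. by case: i j => [[|[|[|i]]]|i] [[|[|[|j]]]|j]. Qed.

Lemma short_diff_comp i j l : short_diff j l \c short_diff i j = 0.
Proof.
by case: i j l => [[|[|[|i]]]|i] [[|[|[|j]]]|j] [[|[|[|l]]]|l];
  rewrite /= ?comp0m ?compm0.
Qed.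

Definition short_sequence : complex A :=
  Complex short_diff_shape short_diff_comp.

Lemma short_sequenceP : short_complex short_sequence R S T.
Proof.
by split=> //; case=> [[|[|[|i]]]|i] // _; apply: zero_objectP.
Qed.

Lemma short_sequence_star_acyclic X Y :
  conflation X Y k f -> star_acyclic X Y short_sequence.
Proof.
have [z0 z1] := zero_objectP A.
move=> [kf cf lf ek]; split=> [P XP n | Q YQ n]; apply/cohomology_eq0P.
  case: n => [[|[|[|n]]]|n] g.
  - move=> e; exists 0.
    rewrite (mono_eq0 (is_kernel_mono kf) (e : k \c g = 0)); exact: compm0.
  - exact: is_kernel_lift kf.
  - by move=> _; have [h fh] := lf P XP g; exists h.
  - move=> _; exists 0; rewrite (z0 _ g); exact: compm0.
  - move=> _; exists 0; rewrite (z0 _ g); exact: compm0.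
case: n => [[|n]|[|[|n]]] g.
- by move=> _; have [h hk] := ek Q YQ g; exists h.
- move=> _; exists 0; rewrite (z1 _ g); exact: comp0m.
- exact: is_cokernel_desc cf.
- move=> e; exists 0.
  rewrite (epi_eq0 (is_cokernel_epi cf) (e : g \c f = 0)); exact: comp0m.
- move=> _; exists 0; rewrite (z1 _ g); exact: comp0m.
Qed.

End ShortComplex.

Lemma enough_projectivesP X Y C D : admissible_balanced_pair X Y ->
  enough_projectives X Y C D <-> enough_proj_conflations X Y C D.
Proof.
move=> adm; have gX := admissible_generating adm; split=> H M.
  have [K [S [T [[K0 K1 K2 zK] aK CS DT]]]] := H M.
  subst S T M; exists (K 1), (K 0), (diff K 0 1), (diff K 1 2); split=> //.
  exact: star_acyclic_conflation.
have [S [T [k [f [cf CS DT]]]]] := H M.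
have [[fk _] _ _ _] := cf.
exists (short_sequence fk), S, T; split=> //.
  exact: short_sequenceP.
exact: short_sequence_star_acyclic.
Qed.

Lemma enough_injectivesP X Y C D : admissible_balanced_pair X Y ->
  enough_injectives X Y C D <-> enough_inj_conflations X Y C D.
Proof.
move=> adm; have gX := admissible_generating adm; split=> H M.
  have [K [S [T [[K0 K1 K2 zK] aK CS DT]]]] := H M.
  subst S T M; exists (K 2), (K 1), (diff K 0 1), (diff K 1 2); split=> //.
  exact: star_acyclic_conflation.
have [S [T [k [f [cf CS DT]]]]] := H M.
have [[fk _] _ _ _] := cf.
exists (short_sequence fk), S, T; split=> //.
  exact: short_sequenceP.
exact: short_sequence_star_acyclic.
Qed.

End Translation.

Theorem theorem3p11 (A : abelian_category) (X Y C D : subcategory A) :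
  admissible_balanced_pair X Y ->
  relative_cotorsion_pair X C D ->
  enough_projectives X Y C D <-> enough_injectives X Y C D.
Proof.
move=> adm [hC hD].
have eX := admissible_enough_X adm; have eY := admissible_enough_Y adm.
rewrite enough_projectivesP // enough_injectivesP //; split.
  apply: salce => // N; rewrite hD; split=> H M CM.
    by apply/(Ext_eq0_vanishes _ _ adm)/H.
  by apply/(Ext_eq0_vanishes _ _ adm)/H.
apply: salce_dual => // M; rewrite hC; split=> H N DN.
  by apply: (ext_coext_vanishes eX); apply/(Ext_eq0_vanishes _ _ adm)/H.
by apply/(Ext_eq0_vanishes _ _ adm)/(coext_ext_vanishes eY)/H.
Qed.
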